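(* Let $r,k,\ell$ be positive integers. If $H$ is an $\ell$-uniform hypergraph with $\chi(H)>r$, then $$R_{\mathrm{list}}(H,k)\ge e^{\sqrt{k\log r/(4\ell)}}.$$ In particular, $R_{\mathrm{list}}(K_3,k)>e^{\sqrt{k}/4}$.
   Context: $K_n^{(\ell)}$ is the complete $\ell$-uniform hypergraph on $n$ vertices; $K_3$ is the triangle (a $2$-uniform hypergraph). Given an assignment $L$ of a set $L_e\subseteq\mathbb{N}$ to each edge $e$ of $K_n^{(\ell)}$, an $L$-colouring is a function $c:E(K_n^{(\ell)})\to\mathbb{N}$ with $c(e)\in L_e$ for all $e$. For an $\ell$-uniform hypergraph $H$ and a positive integer $k$, the list Ramsey number $R_{\mathrm{list}}(H,k)$ is the smallest $n$ for which there exists an assignment $L$ of lists with $|L_e|=k$ for every $e\in E(K_n^{(\ell)})$ such that every $L$-colouring of $E(K_n^{(\ell)})$ contains a monochromatic copy of $H$ (a not necessarily induced subhypergraph isomorphic to $H$ all of whose edges have the same colour). The chromatic number $\chi(H)$ is the smallest integer $s$ such that the vertices of $H$ can be coloured with $s$ colours with no edge of $H$ monochromatic. Logarithms are natural. *)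

(* Defs.v *)
From mathcomp Require Import all_boot finmap.

Set Implicit Arguments.
Unset Strict Implicit.
Unset Printing Implicit Defensive.

Record uhypergraph (l : nat) := UHypergraph {
  vertex : finType;
  edges : {set {set vertex}};
  uniform : forall e, e \in edges -> #|e| = l
}.

Lemma complete_uniform (n l : nat) (e : {set 'I_n}) :
  e \in [set e : {set 'I_n} | #|e| == l] -> #|e| = l.
Proof. by rewrite inE => /eqP. Qed.

Definition complete_hypergraph (n l : nat) : uhypergraph l :=
  UHypergraph (@complete_uniform n l).

Definition K3 : uhypergraph 2 := complete_hypergraph 3 2.

Definition is_least (P : nat -> Prop) (n : nat) : Prop :=
  P n /\ forall m, P m -> n <= m.

Section Chromatic.
Variables (l : nat) (H : uhypergraph l).

Definition monochromatic (s : nat) (c : vertex H -> 'I_s)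
    (e : {set vertex H}) : Prop :=
  exists i, forall v, v \in e -> c v = i.

Definition colourable (s : nat) : Prop :=
  exists c : vertex H -> 'I_s, forall e, e \in edges H -> ~ monochromatic c e.

(* A relation rather than a function: if l = 1 and H has an edge, then H is
   not colourable with any number of colours and has no chromatic number. *)
Definition is_chromatic_number (chi : nat) : Prop := is_least colourable chi.

End Chromatic.

Section ListRamsey.
Variable l : nat.

(* The subhypergraph of G with vertex set W and edge set F is isomorphic to H:
   f is an isomorphism from H onto it. *)
Definition is_copy (H G : uhypergraph l)
    (W : {set vertex G}) (F : {set {set vertex G}}) : Prop :=
  F \subset edges G /\
  exists f : vertex H -> vertex G,
    [/\ injective f, f @: [set: vertex H] = W
      & [set f @: (e : {set vertex H}) | e in edges H] = F].

(* Only the values of an edge colouring or of a list assignment on the edges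
   of G matter below. *)
Definition has_monochromatic_copy (H G : uhypergraph l)
    (c : {set vertex G} -> nat) : Prop :=
  exists W F, is_copy H W F /\ exists i, forall e, e \in F -> c e = i.

Definition list_colouring (G : uhypergraph l)
    (L : {set vertex G} -> {fset nat}) (c : {set vertex G} -> nat) : Prop :=
  forall e, e \in edges G -> c e \in L e.

Definition list_ramsey_at (H : uhypergraph l) (k n : nat) : Prop :=
  let G := complete_hypergraph n l in
  exists L : {set vertex G} -> {fset nat},
    (forall e, e \in edges G -> #|` L e| = k) /\
    forall c, list_colouring L c -> has_monochromatic_copy H c.

Definition is_list_ramsey_number (H : uhypergraph l) (k N : nat) : Prop :=
  is_least (list_ramsey_at H k) N.

End ListRamsey.

(* Main.v *)
Require Import Defs.
From mathcomp Require Import all_boot all_order all_algebra.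
From mathcomp Require Import finmap.
From mathcomp Require Import reals sequences exp.
From mathcomp Require Import zify lra.

Set Implicit Arguments.
Unset Strict Implicit.
Unset Printing Implicit Defensive.

Import Order.TTheory GRing.Theory Num.Theory.
Local Open Scope ring_scope.

(** Suppose that H cannot be properly coloured with r colours. To every colour i
    assign a map g_i from the n vertices to r classes, and give an edge e a
    colour i of its list such that g_i is not constant on e. Then g_i is a
    proper r-colouring of the edges of colour i, so a monochromatic copy of H in
    colour i would pull back to a proper r-colouring of H, which is impossible.

    It remains to choose the maps so that every edge has such a colour. If they
    are chosen uniformly and independently at random, then g_i is constant on a
    given l-set with probability r^-(l-1), hence all the k maps attached to the
    list of a given edge fail with probability r^-((l-1)k). By the union bound a
    good choice exists as soon as C(n,l) < r^((l-1)k)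
    ([exists_maps_breaking_edges]), so every n at which some lists force a
    monochromatic copy satisfies r^((l-1)k) <= C(n,l)
    ([list_ramsey_at_lower_bound]). The probabilities are replaced by
    cardinalities of families of maps.

    The announced bounds follow by taking logarithms. With x = k log r and
    C(n,l) <= n^l one gets log n >= (l-1)x/l >= x/2 for l >= 2, and x/2 is at
    least sqrt(x/(4l)) because x is either 0 or at least log 2 >= 1/2. An
    l-uniform H with a chromatic number larger than 1 has l >= 2, since no
    1-element edge can be non-monochromatic. For the triangle r = l = 2, and
    C(n,2) < n^2 makes the inequality strict. *)

(** * Counting maps that are constant on a set *)

(** The union bound. *)
Lemma card_le_sum (T I : finType) (A : pred I) (P : pred T)
    (Q : I -> pred T) :
    (forall x, P x -> exists2 i, A i & Q i x) ->
  (#|P| <= \sum_(i | A i) #|Q i|)%N.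
Proof.
move=> PQ; rewrite -sum1_card.
have -> : (\sum_(i | A i) #|Q i| = \sum_(i | A i) \sum_x Q i x)%N.
  by apply: eq_bigr => i _; rewrite -sum1_card big_mkcond.
rewrite exchange_big /= big_mkcond /=; apply: leq_sum => x _.
case: ifP => // /PQ[i Ai Qix].
by rewrite (bigD1 i) //= Qix.
Qed.

Lemma card_forced_on (I W : finType) (S : {set I}) (P : pred W) :
  #|[pred g : {ffun I -> W} | [forall i in S, P (g i)]]|
    = (#|P| ^ #|S| * #|W| ^ #|~: S|)%N.
Proof.
pose F i : pred W := if i \in S then P else predT.
have -> : #|[pred g : {ffun I -> W} | [forall i in S, P (g i)]]| = #|family F|.
  apply: eq_card => g; rewrite inE; apply/forall_inP/familyP => gP i.
    by rewrite /F unfold_in; case: ifP => // /gP.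
  by move=> iS; have := gP i; rewrite /F iS.
rewrite card_family foldrE big_map big_enum /=.
rewrite (bigID (mem S)) /= -!prod_nat_const; congr muln.
  by apply: eq_bigr => i iS; rewrite /F iS.
rewrite [RHS](eq_bigl (fun i => i \notin S)) => [|i]; last by rewrite inE.
by apply: eq_bigr => i /negbTE iS; rewrite /F iS.
Qed.

Definition constant_on (V T : finType) (g : {ffun V -> T}) (e : {set V}) :=
  [exists a, [forall v in e, g v == a]].

(** Divided by the total number of maps, this says that a uniformly random
    map is constant on [e] with probability at most [#|T| ^- #|e|.-1]: there are
    [#|T|] choices for the common value, and [g] is then forced on [e]. *)
Lemma card_constant_on (V T : finType) (e : {set V}) : (0 < #|e|)%N ->
  (#|T| ^ #|e|.-1 * #|[pred g : {ffun V -> T} | constant_on g e]|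
     <= #|T| ^ #|V|)%N.
Proof.
move=> e_gt0.
pose Q (a : T) : pred {ffun V -> T} :=
  [pred g : {ffun V -> T} | [forall v in e, pred1 a (g v)]].
have le_card : (#|[pred g : {ffun V -> T} | constant_on g e]|
    <= \sum_a #|Q a|)%N.
  by apply: card_le_sum => g /existsP[a g_a]; exists a.
apply: leq_trans (leq_mul (leqnn _) le_card) _.
have cardQ a : #|Q a| = (#|T| ^ #|~: e|)%N.
  by rewrite card_forced_on card1 exp1n mul1n.
under eq_bigr => a _ do rewrite cardQ.
rewrite sum_nat_const -(cardsC e) mulnA -expnSr prednK //.
by rewrite -expnD.
Qed.

(** * Avoiding monochromatic copies *)

(** The probabilistic step: [C] is the set of colours and [S e] the list of [e].
    A choice [g] is bad for [e] when all the maps with index in [S e] are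
    constant on [e]; this is a proportion at most [r ^- (l.-1 * k)] of all the
    choices, so fewer than [r ^ (l.-1 * k)] edges cannot exhaust them. *)
Lemma exists_maps_breaking_edges (V C : finType) (l k r : nat)
    (E : {set {set V}}) (S : {set V} -> {set C}) :
    (forall e, e \in E -> #|e| = l) -> (forall e, e \in E -> #|S e| = k) ->
    (0 < l)%N -> (0 < r)%N -> (#|E| < r ^ (l.-1 * k))%N ->
  exists g : C -> {ffun V -> 'I_r},
    forall e, e \in E -> exists2 i, i \in S e & ~~ constant_on (g i) e.
Proof.
move=> uniE cardS l_gt0 r_gt0 small.
pose W := {ffun V -> 'I_r}.
pose bad (e : {set V}) : pred {ffun C -> W} :=
  [pred g : {ffun C -> W} | [forall i in S e, constant_on (g i) e]].
have W_gt0 : (0 < #|W|)%N by rewrite card_ffun card_ord expn_gt0 r_gt0.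
have bad_le e : e \in E -> (r ^ (l.-1 * k) * #|bad e| <= #|W| ^ #|C|)%N.
  move=> eE; pose P : pred W := [pred g | constant_on g e].
  rewrite (card_forced_on (S e) P) mulnA -(cardsC (S e)) expnD leq_mul //.
  rewrite cardS // expnM -expnMn.
  have [->|k_gt0] := posnP k; first by rewrite !expn0.
  rewrite leq_exp2r // card_ffun -{1}(card_ord r) -(uniE e eE).
  by apply: card_constant_on; rewrite uniE.
case: (pickP [pred g : {ffun C -> W} |
    [forall e in E, [exists (i | i \in S e), ~~ constant_on (g i) e]]]).
  move=> g /forall_inP gE; exists g => e /gE/exists_inP[i iS Ni].
  by exists i.
move=> allbad; exfalso.
have total_le : (#|{ffun C -> W}| <= \sum_(e in E) #|bad e|)%N.
  apply: card_le_sum => g _; have /negbT := allbad g.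
  rewrite negb_forall_in => /exists_inP[e eE]; rewrite negb_exists_in.
  move=> /forall_inP gbad; exists e => //; apply/forall_inP => i /gbad.
  by rewrite negbK.
rewrite card_ffun in total_le.
have := leq_mul (leqnn (r ^ (l.-1 * k))%N) total_le.
rewrite big_distrr /= leqNgt => /negP; apply.
apply: (@leq_ltn_trans (\sum_(e in E) #|W| ^ #|C|)); first exact: leq_sum.
by rewrite sum_nat_const ltn_pmul2r // expn_gt0 W_gt0.
Qed.

(** If the bound fails, the colouring built from [exists_maps_breaking_edges]
    has colour classes that are properly coloured with [r] colours by the maps
    [g i]; composing with the embedding of a monochromatic copy would colour
    [H]. *)
Lemma list_ramsey_at_lower_bound (l : nat) (H : uhypergraph l) (k r n : nat) :
    (0 < l)%N -> (0 < r)%N -> ~ colourable H r -> list_ramsey_at H k n ->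
  (r ^ (l.-1 * k) <= 'C(n, l))%N.
Proof.
move=> l_gt0 r_gt0 ncol [L [cardL forced]].
rewrite leqNgt; apply/negP => small; apply: ncol.
set E := edges (complete_hypergraph n l) in cardL.
have uniE e : e \in E -> #|e| = l by exact: uniform.
(* The lists use only the finitely many colours up to m, so they are sets over
   the finite type 'I_m.+1. *)
pose m := (\max_(e in E) \max_(i <- L e) i)%N.
have le_m e i : e \in E -> i \in L e -> (i <= m)%N.
  move=> eE iL; apply: leq_trans (leq_bigmax_cond _ eE).
  by apply: (@leq_bigmax_seq _ (enum_fset (L e)) xpredT id).
pose S (e : {set 'I_n}) := [set i : 'I_m.+1 | val i \in L e].
have cardS e : e \in E -> #|S e| = k.
  move=> eE; rewrite -(cardL e eE) cardE -(size_map val).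
  apply/perm_size/uniq_perm; rewrite ?fset_uniq //.
    by rewrite map_inj_uniq ?enum_uniq //; exact: val_inj.
  move=> i; apply/mapP/idP => [[j]|iL]; first by rewrite mem_enum inE => ? ->.
  exists (inord i); last by rewrite /= inordK // ltnS (le_m e).
  by rewrite mem_enum inE /= inordK // ltnS (le_m e).
have [|g gP] := @exists_maps_breaking_edges _ _ _ _ r E S uniE cardS l_gt0 r_gt0.
  by rewrite /E /= card_draws card_ord.
(* The value 0 is only taken outside E, where colours are irrelevant. *)
pose colour e := if [pick i in S e | ~~ constant_on (g i) e] is Some i
  then val i else 0%N.
have colourP e : e \in E ->
    (colour e \in L e) /\ ~~ constant_on (g (inord (colour e))) e.
  move=> eE; rewrite /colour; case: pickP => [i /andP[]|none].
    by rewrite inE inord_val.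
  by have [i iS Ni] := gP e eE; have := none i; rewrite /= iS Ni.
have [|W [F [[sub [f [_ _ defF]]] [i mono]]]] := forced colour.
  by move=> e /colourP[].
exists (fun v => g (inord i) (f v)) => e eH [a ca].
have img : f @: e \in F by rewrite -defF; exact: imset_f.
have [_ /existsP[]] := colourP _ (subsetP sub _ img).
exists a; apply/forall_inP => _ /imsetP[v ve ->].
by rewrite (mono _ img) ca.
Qed.

(** A one-vertex edge is monochromatic in every colouring, so a colourable
    1-uniform hypergraph has no edges. *)
Lemma colourable_uniform1 (H : uhypergraph 1) (s r : nat) :
  (0 < r)%N -> colourable H s -> colourable H r.
Proof.
move=> r0 [c proper]; exists (fun=> Ordinal r0) => e eH.
case: (proper e eH); have /eqP/cards1P[x ->] := uniform eH.
by exists (c x) => v /set1P->.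
Qed.

Lemma K3_not_2_colourable : ~ colourable K3 2.
Proof.
case=> c proper; have : ~~ injectiveb c.
  by apply/negP => /injectiveP/leq_card; rewrite !card_ord.
case/injectivePn => x [y x_neq_y cxy].
apply: (proper [set x; y]); first by rewrite inE cards2 x_neq_y.
by exists (c x) => v /set2P[] ->.
Qed.

(** * Numerical bounds *)

Lemma bin_le_exp (n l : nat) : ('C(n, l) <= n ^ l)%N.
Proof.
apply: leq_trans (leq_pmulr _ (fact_gt0 l)) _.
rewrite bin_ffact ffact_prod -[l in X in (_ <= X)%N]card_ord -prod_nat_const.
by apply: leq_prod => i _; exact: leq_subr.
Qed.

Lemma ln2_ge_half (R : realType) : 1 / 2 <= ln (2 : R).
Proof.
have := @le_ln1Dx R (- (1 / 2)); have -> : 1 + - (1 / 2) = 2^-1 :> R by lra.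
rewrite lnV ?posrE //; lra.
Qed.

Lemma list_ramsey_at_expR_le (R : realType) (l : nat) (H : uhypergraph l)
    (k r N : nat) :
    (1 < l)%N -> (0 < r)%N -> (0 < k)%N -> ~ colourable H r ->
    list_ramsey_at H k N ->
  expR (Num.sqrt (k%:R * ln (r%:R : R) / (4 * l%:R))) <= N%:R.
Proof.
move=> l2 r0 k0 ncol at_N; have l0 := ltnW l2; have half_ln2 := ln2_ge_half R.
have bound : (r ^ (l.-1 * k) <= N ^ l)%N.
  apply: leq_trans (bin_le_exp N l).
  exact: (list_ramsey_at_lower_bound l0 r0 ncol at_N).
have N0 : (0 < N)%N.
  case: posnP bound => // ->.
  by rewrite exp0n // leqn0 expn_eq0 (gtn_eqF r0).
have [r_R N_R] : 0 < r%:R :> R /\ 0 < N%:R :> R by rewrite !ltr0n.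
set x : R := k%:R * ln r%:R.
have ln_bound : l.-1%:R * x <= l%:R * ln (N%:R : R).
  rewrite /x mulrA -natrM !mulr_natl -!lnXn // ler_ln ?posrE ?exprn_gt0 //.
  by rewrite -!natrX ler_nat.
have x_val : x = 0 \/ 1 / 2 <= x.
  case: (ltnP 1 r) => r1; last first.
    by left; rewrite /x (_ : r = 1)%N ?ln1 ?mulr0 //; lia.
  right; have : ln (2 : R) <= ln r%:R by rewrite ler_ln ?posrE // ler_nat.
  have : 1 <= k%:R :> R by rewrite ler1n.
  rewrite /x; nra.
have l2_R : 2 <= l%:R :> R by rewrite ler_nat.
have lpred : l.-1%:R = l%:R - 1 :> R by rewrite -subn1 natrB.
have x_le : x / 2 <= ln (N%:R : R).
  rewrite lpred in ln_bound; case: x_val => x_val; nra.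
rewrite -[leRHS]lnK ?posrE // ler_expR; apply: le_trans x_le.
(* Once squared, the goal is x / (4 l) <= x ^ 2 / 4, that is x = 0 or 1 / l <= x. *)
have x2_ge0 : 0 <= x / 2 by lra.
rewrite -(ger0_norm x2_ge0) -sqrtr_sqr ler_wsqrtr //.
rewrite ler_pdivrMr; last lra.
case: x_val => x_val; nra.
Qed.

Lemma list_ramsey_at_K3_expR_lt (R : realType) (k N : nat) :
    (0 < k)%N -> list_ramsey_at K3 k N ->
  expR (Num.sqrt (k%:R : R) / 4) < N%:R.
Proof.
move=> k0 at_N; have half_ln2 := ln2_ge_half R.
(* The factor 1/2 in C(N,2) = N(N-1)/2 provides the strict inequality. *)
have bound : (2 ^ k < N ^ 2)%N.
  have := list_ramsey_at_lower_bound (ltn0Sn 1) (ltn0Sn 1) K3_not_2_colourable at_N.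
  rewrite mul1n bin2 => le_bin; have := expn_gt0 2 k => /= pos.
  have : (2 ^ k * 2 <= N * N.-1)%N.
    apply: leq_trans (leq_mul le_bin (leqnn 2)) _.
    by rewrite muln2 -{2}(odd_double_half (N * N.-1)) leq_addl.
  rewrite expnS expn1; nia.
have N_R : 0 < N%:R :> R by rewrite ltr0n; case: N bound {at_N}.
have ln_bound : k%:R * ln (2 : R) < 2 * ln (N%:R : R).
  rewrite !mulr_natl -!lnXn // ltr_ln ?posrE ?exprn_gt0 //.
  by rewrite -!natrX ltr_nat.
rewrite -[ltRHS]lnK ?posrE // ltr_expR.
have k_R : 1 <= k%:R :> R by rewrite ler1n.
have : Num.sqrt (k%:R : R) <= k%:R.
  rewrite -[leRHS]ger0_norm; last lra.
  rewrite -sqrtr_sqr ler_wsqrtr //; nra.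
nra.
Qed.

Theorem theorem6 (R : realType) :
  (forall (r k l : nat), (0 < r)%N -> (0 < k)%N -> (0 < l)%N ->
     forall (H : uhypergraph l) (chi : nat),
       is_chromatic_number H chi -> (r < chi)%N ->
     forall N : nat, is_list_ramsey_number H k N ->
       expR (Num.sqrt (k%:R * ln (r%:R : R) / (4 * l%:R))) <= N%:R)
  /\
  (forall k : nat, (0 < k)%N ->
     forall N : nat, is_list_ramsey_number K3 k N ->
       expR (Num.sqrt (k%:R : R) / 4) < N%:R).
Proof.
split=> [r k l r0 k0 l0 H chi [col least] r_chi|k k0] N [at_N _]; last first.
  exact: list_ramsey_at_K3_expR_lt at_N.
have ncol : ~ colourable H r by move=> /least; rewrite leqNgt r_chi.
apply: list_ramsey_at_expR_le at_N => //.
rewrite ltn_neqAle l0 andbT; apply/eqP => l1; apply: ncol.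
by case: l / l1 H col {l0 least} => H; exact: colourable_uniform1.
Qed.
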